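(* Let $G$ be a finite simple graph with at least one vertex. Then $\ell(G)=c(G)$ if and only if $G$ is a CL-graph.
   Context: For a connected graph $H$, $\ell(H)$ denotes the length (number of edges) of a longest induced path in $H$; for an arbitrary graph $G$ with connected components $G_1,\dots,G_t$, $\ell(G)=\ell(G_1)+\cdots+\ell(G_t)$. $c(G)$ denotes the number of maximal cliques of $G$ (a clique is a set of pairwise adjacent vertices). Intersection graph: given a finite list of sets $S_1,\dots,S_m$, the intersection graph on this list has one vertex for each $S_i$ (distinct indices give distinct vertices), and the vertices corresponding to $S_i$ and $S_j$ ($i\neq j$) are adjacent iff $S_i\cap S_j\neq\emptyset$. Connected CL-graph: let $\ell\in\mathbb{N}=\{1,2,\dots\}$ and $r\in\mathbb{N}_0=\{0,1,2,\dots\}$, and let $J_0,J_1,\dots,J_\ell,I_1,\dots,I_r$ be subsets of $\mathbb{R}$ such that: (i) $J_0=\{0\}$ and $J_j=[j-1,j]$ for $1\le j\le \ell$; (ii) for each $1\le i\le r$ there is some $t\in\mathbb{N}$ with $I_i=[a_1,b_1]\cup[a_2,b_2]\cup\cdots\cup[a_t,b_t]$, where $a_1,\dots,a_t\in\mathbb{N}_0$, $b_1,\dots,b_t\in\mathbb{R}$, $a_1<b_1<a_2<b_2<\cdots<a_t<b_t<\ell$, and $a_{k+1}-b_k>2$ for all $1\le k\le t-1$; (iii) if $\{I_{i_1},\dots,I_{i_t}\}\subseteq\{I_1,\dots,I_r\}$ satisfies $I_{i_p}\cap I_{i_q}\neq\emptyset$ for all $1\le p<q\le t$, then $\bigcap_{k=1}^t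 I_{i_k}\neq\emptyset$; (iv) if $I_p\cap I_q\neq\emptyset$ and $j\in I_p\setminus I_q$ for some $j\in\mathbb{N}_0$, then ($j+1\notin I_p$ implies $j+1\notin I_q$) and ($j-1\notin I_p$ implies $j-1\notin I_q$). The intersection graph on $J_0,\dots,J_\ell,I_1,\dots,I_r$ is called a connected CL-graph. A graph is a CL-graph if every connected component of it is isomorphic to a connected CL-graph. *)

(* Defs.v *)
From Stdlib Require Import Reals.
From mathcomp Require Import all_boot.

Set Implicit Arguments.
Unset Strict Implicit.
Unset Printing Implicit Defensive.

(* A finite simple graph is a symmetric irreflexive relation e on a finType T. *)

Section Graphs.
Variable T : finType.
Variable e : rel T.

Definition components : {set {set T}} :=
  [set [set y | connect e x y] | x : T].

Definition induced_path_in (C : {set T}) n (t : n.-tuple T) : bool :=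
  [&& uniq t, all (fun v => v \in C) t &
      [forall i : 'I_n, forall j : 'I_n,
         e (tnth t i) (tnth t j) == ((i.+1 == j :> nat) || (j.+1 == i :> nat))]].

Definition longest_induced_path (C : {set T}) : nat :=
  \max_(k < #|T|.+1 | [exists t : k.+1.-tuple T, induced_path_in C t]) k.

Definition ell : nat := \sum_(C in components) longest_induced_path C.

Definition clique (A : {set T}) : bool :=
  [forall x in A, forall y in A, (x != y) ==> e x y].

Definition num_max_cliques : nat := #|[set A : {set T} | maxset clique A]|.

End Graphs.

Definition in_union (s : seq (nat * R)) (x : R) : Prop :=
  exists k, (k < size s)%N /\
    Rle (INR (nth (0%N, R0) s k).1) x /\ Rle x (nth (0%N, R0) s k).2.

Fixpoint chain_ok (l : nat) (s : seq (nat * R)) : Prop :=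
  match s with
  | [::] => True
  | (a, b) :: s' =>
      Rlt (INR a) b /\
      match s' with
      | [::] => Rlt b (INR l)
      | (a', _) :: _ => Rlt (INR 2) (Rminus (INR a') b)
      end /\ chain_ok l s'
  end.

(* The family J_0, ..., J_l, I_1, ..., I_r, indexed by 0 .. l + r. *)
Definition CLfam (l : nat) (Is : seq (seq (nat * R))) (k : nat) (x : R) : Prop :=
  if (k <= l)%N then
    (if k == 0%N then x = R0
     else Rle (Rminus (INR k) R1) x /\ Rle x (INR k))
  else in_union (nth [::] Is (k - l.+1)) x.

Definition CL_conditions (l : nat) (Is : seq (seq (nat * R))) : Prop :=
  (0 < l)%N /\
  (forall i, (i < size Is)%N ->
     (0 < size (nth [::] Is i))%N /\ chain_ok l (nth [::] Is i)) /\
  (forall S : {set 'I_(size Is)},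
     (forall p q, p \in S -> q \in S -> p != q ->
        exists x, in_union (nth [::] Is p) x /\ in_union (nth [::] Is q) x) ->
     exists x, forall p, p \in S -> in_union (nth [::] Is p) x) /\
  (forall (p q : 'I_(size Is)) (j : nat),
     (exists x, in_union (nth [::] Is p) x /\ in_union (nth [::] Is q) x) ->
     in_union (nth [::] Is p) (INR j) -> ~ in_union (nth [::] Is q) (INR j) ->
     (~ in_union (nth [::] Is p) (Rplus (INR j) R1) ->
        ~ in_union (nth [::] Is q) (Rplus (INR j) R1)) /\
     (~ in_union (nth [::] Is p) (Rminus (INR j) R1) ->
        ~ in_union (nth [::] Is q) (Rminus (INR j) R1))).

Definition iso_connected_CL (T : finType) (e : rel T) (C : {set T}) : Prop :=
  exists (l : nat) (Is : seq (seq (nat * R))),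
    CL_conditions l Is /\
    exists f : 'I_(l.+1 + size Is) -> T,
      injective f /\ f @: setT = C /\
      (forall u v : 'I_(l.+1 + size Is), u != v ->
         (e (f u) (f v) <->
          exists x, CLfam l Is u x /\ CLfam l Is v x)).

Definition is_CL_graph (T : finType) (e : rel T) : Prop :=
  forall C, C \in components e -> iso_connected_CL e C.

(* Main.v *)
Require Import Defs.
From Stdlib Require Import Reals Lra.
From mathcomp Require Import all_boot zify.

(** An induced path v_0, ..., v_l of a component C gives l distinct maximal
cliques of C, one through each edge, so l(C) <= c(C) for every component and
the global equality splits into equalities for the components.

A member of a CL-family is determined, as far as intersections go, by the
integers of {0, ..., l-1} it contains: J_j stands for {j-1, j}, and rounding
down a common point of two sets gives a common integer.  Conditions (ii)-(iv)
force every clique to have a common integer; hence there are at most l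
maximal cliques, while J_0, ..., J_l is an induced path of length l.

Conversely, if l(C) = c(C) = l, the maximal cliques of C are the cliques
K_0, ..., K_(l-1) through the edges v_j v_(j+1) of a longest induced path, and
each remaining vertex x is represented by a union of intervals whose integers
are the j with x in K_j.  Conditions (ii) and (iv) hold because a triangle
through some v_j lies in K_(j-1) or in K_j, and (iii) because every clique
lies in some K_j. *)

Set Implicit Arguments.
Unset Strict Implicit.
Unset Printing Implicit Defensive.

(** * Finite unions of intervals and the integers they contain *)

Lemma in_union_nil x : ~ in_union [::] x.
Proof. by case=> k []. Qed.

Lemma in_union_cons a b s x :
  in_union ((a, b) :: s) x <-> Rle (INR a) x /\ Rle x b \/ in_union s x.
Proof.
split=> [[[|k] [ltk mx]]|[mx|[k [ltk mx]]]].
- by left.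
- by right; exists k.
- by exists 0.
- by exists k.+1.
Qed.

Lemma chain_ok_tail l a b s : chain_ok l ((a, b) :: s) -> chain_ok l s.
Proof. by case=> _ []. Qed.

Lemma chain_ok_lt l a b s : chain_ok l ((a, b) :: s) -> Rlt (INR a) b.
Proof. by case. Qed.

(** The gap condition bounds the next interval only; the later ones start further right, since each
    right end exceeds its left end. *)
Lemma chain_ok_gap l a b s x :
  chain_ok l ((a, b) :: s) -> in_union s x -> Rlt (Rplus b (INR 2)) x.
Proof.
elim: s a b => [|[a' b'] s IHs] a b ok_s; first by move/in_union_nil.
have ok_s' := chain_ok_tail ok_s; have ltab' := chain_ok_lt ok_s'.
have [_ [gap _]] := ok_s.
case/in_union_cons=> [[lea' _] | /(IHs _ _ ok_s') ltb'x]; rewrite /= in gap *.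
  lra.
by rewrite /= in ltb'x; lra.
Qed.

Lemma chain_ok_bounds l s x :
  chain_ok l s -> in_union s x -> Rle 0 x /\ Rlt x (INR l).
Proof.
elim: s x => [|[a b] s IHs] x ok_s; first by move/in_union_nil.
case/in_union_cons=> [[leax lexb] | s_x]; last exact: IHs (chain_ok_tail ok_s) s_x.
have := pos_INR a; split; first lra.
case: s IHs ok_s => [|[a' b'] s] IHs ok_s; first by case: ok_s => _ [/=]; lra.
have s_a': in_union ((a', b') :: s) (INR a').
  apply/in_union_cons; left; have := chain_ok_lt (chain_ok_tail ok_s); lra.
have [_] := IHs _ (chain_ok_tail ok_s) s_a'.
by have := chain_ok_gap ok_s s_a'; rewrite /=; lra.
Qed.

Lemma nat_floor x : Rle 0 x ->
  exists n : nat, Rle (INR n) x /\ Rlt x (Rplus (INR n) 1).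
Proof.
move=> x_ge0; have [N ltxN] := INR_unbounded x.
elim: N ltxN => [|N IHN] ltxN; first by rewrite /= in ltxN; lra.
have [ltx|lex] := Rlt_le_dec x (INR N); first exact: IHN.
by exists N; split=> //; rewrite S_INR in ltxN.
Qed.

Lemma INR_ltP m n : reflect (Rlt (INR m) (INR n)) (m < n).
Proof.
apply: (iffP idP) => [ltmn | /INR_lt]; last by lia.
by apply: lt_INR; lia.
Qed.

Lemma INR_leP m n : reflect (Rle (INR m) (INR n)) (m <= n).
Proof.
apply: (iffP idP) => [ltmn | /INR_le]; last by lia.
by apply: le_INR; lia.
Qed.

(* The left ends are integers, so rounding down stays inside an interval. *)
Lemma in_union_floor s n x :
  Rle (INR n) x -> Rlt x (Rplus (INR n) 1) -> in_union s x -> in_union s (INR n).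
Proof.
move=> lenx ltxn [k [ltk [lea leb]]]; exists k; split=> //; split; last lra.
apply/INR_leP; rewrite -ltnS; apply/INR_ltP; rewrite S_INR; lra.
Qed.

(** Gaps are longer than 2, so [j] and [j.+2] lie in the same interval, which also contains
    [j.+1]. *)
Lemma in_union_bridge l s j : chain_ok l s ->
  in_union s (INR j) -> in_union s (INR j.+2) -> in_union s (INR j.+1).
Proof.
elim: s => [|[a b] s IHs] ok_s; first by move/in_union_nil.
have := IHs (chain_ok_tail ok_s); rewrite !in_union_cons !S_INR => {}IHs.
case=> [[laj ljb]|s_j] [[laj2 lj2b]|s_j2].
- by left; lra.
- by have := chain_ok_gap ok_s s_j2; rewrite /=; lra.
- by have := chain_ok_gap ok_s s_j; rewrite /=; lra.
- by right; apply: IHs.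
Qed.

Definition int_trace (s : seq (nat * R)) (j : nat) : bool :=
  has (fun ab => Rle_dec (INR ab.1) (INR j) && Rle_dec (INR j) ab.2) s.

Lemma int_traceP s j : reflect (in_union s (INR j)) (int_trace s j).
Proof.
apply: (iffP (has_nthP (0, R0))) => [[k ltk /andP[leaj lejb]]|[k [ltk [leaj lejb]]]].
  exists k; split=> //.
  by move: leaj lejb; case: Rle_dec; case: Rle_dec.
by exists k => //; do 2![case: Rle_dec => [?|]//].
Qed.

Lemma int_trace_lt l s j : chain_ok l s -> int_trace s j -> j < l.
Proof. by move=> ok_s /int_traceP/(chain_ok_bounds ok_s)[_ /INR_ltP]. Qed.

Lemma int_trace_floor l s x : chain_ok l s -> in_union s x ->
  exists n, [/\ Rle (INR n) x, Rlt x (Rplus (INR n) 1), n < l & int_trace s n].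
Proof.
move=> ok_s s_x; have [x_ge0 _] := chain_ok_bounds ok_s s_x.
have [n [lenx ltxn]] := nat_floor x_ge0.
have s_n: int_trace s n by apply/int_traceP/(in_union_floor lenx ltxn).
by exists n; split=> //; apply: int_trace_lt s_n.
Qed.

(** A common point can be rounded down inside both sets, and [chain_ok] places its floor in 0, ...,
    l - 1. *)
Lemma int_trace_meet l s1 s2 : chain_ok l s1 ->
  (exists x, in_union s1 x /\ in_union s2 x) <->
  (exists2 j, j < l & int_trace s1 j && int_trace s2 j).
Proof.
move=> ok1; split=> [[x [s1x s2x]] | [j _ /andP[/int_traceP s1j /int_traceP s2j]]].
  have [n [lenx ltxn ltnl s1n]] := int_trace_floor ok1 s1x.
  by exists n => //; rewrite s1n; apply/int_traceP/(in_union_floor lenx ltxn).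
by exists (INR j).
Qed.

(* Each maximal run a, ..., b of S becomes the interval [a, b + 1/2]. *)
Lemma runs_of l (S : pred nat) :
    (forall j, S j -> j < l) ->
    (forall j, S j -> S j.+2 -> S j.+1) ->
  {s | chain_ok l s /\ forall j, int_trace s j = S j}.
Proof.
move=> S_lt S_gap.
(* The list is built from right to left: [a] decreases from [l], and only the integers of [S] from
   [a] on are realised. *)
suff runs_above n a: a + n = l ->
    {s | chain_ok l s /\ forall j, in_union s (INR j) <-> (a <= j) && S j}.
  have [s [ok_s s_S]] := runs_above l 0 (add0n l).
  exists s; split=> // j; apply/int_traceP/idP; first by move/s_S.
  by move=> Sj; apply/s_S.
elim: n a => [|n IHn] a def_l.
  exists [::]; split=> // j; split=> [/in_union_nil // | /andP[le_aj /S_lt]]; lia.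
have [|s [ok_s s_S]] := IHn a.+1; first by lia.
have [Sa|S'a] := boolP (S a); last first.
  exists s; split=> // j; rewrite s_S; split; first by move/andP=> [? ->]; lia.
  move=> /andP[leaj Sj]; rewrite Sj andbT ltn_neqAle leaj andbT.
  by apply: contraNneq S'a => ->.
case: s => [|[c b] s] in ok_s s_S *.
  (* Adding 1/2 makes the interval nondegenerate without a new integer, and [a.+1 <= l] keeps its
     right end below [l]. *)
  exists [:: (a, Rplus (INR a) (Rdiv 1 2))]; split.
    split; first lra.
    split=> //; have/INR_leP: a.+1 <= l by lia.
    by rewrite S_INR; lra.
  move=> j; rewrite in_union_cons; split.
    case=> [[/INR_leP leaj leja]|/in_union_nil//]; rewrite leaj /=.
    suff ->: j = a by [].
    apply/eqP; rewrite eqn_leq leaj andbT -ltnS; apply/INR_ltP; rewrite S_INR; lra.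
  case/andP; rewrite leq_eqVlt => /predU1P[<- _|ltaj Sj]; first by left; lra.
  by right; apply/s_S; rewrite ltaj.
have ltcb := chain_ok_lt ok_s.
have s_c: in_union ((c, b) :: s) (INR c) by apply/in_union_cons; left; lra.
have /s_S/andP[ltac Sc] := s_c.
have [eqc|neqc] := eqVneq c a.+1.
  exists ((a, b) :: s); split.
    case: ok_s => ? [? ?]; split=> //.
    by have: Rlt (INR a) (INR c); [apply/INR_ltP; lia | lra].
  move=> j; rewrite in_union_cons; have := s_S j; rewrite in_union_cons.
  move=> [s_S1 s_S2]; split.
    case=> [[/INR_leP leaj lejb]|s_j].
      move: (leaj); rewrite leq_eqVlt => /predU1P[<- | ltaj]; first by rewrite eqxx.
      have/andP[_ Sj]: (a < j) && S j; last by rewrite Sj ltaj orbT.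
      by apply: s_S1; left; split=> //; apply/INR_leP; lia.
    by have/andP[? ->]: (a < j) && S j; [apply: s_S1; right | lia].
  case/andP; rewrite leq_eqVlt => /predU1P[<- _|ltaj Sj].
    left; have: Rlt (INR a) (INR c) by apply/INR_ltP; lia.
    by lra.
  have [|[/INR_leP lecj ?]|] := s_S2; [by rewrite ltaj | | by right].
  by left; split=> //; apply/INR_leP; lia.
(* If c were a + 2, then [S_gap] would put [a.+1] in [S], below every interval built so far. Hence c
   is at least a + 3, and the gap from a + 1/2 to c exceeds 2. *)
have lt_a2c: a.+2 < c.
  rewrite ltn_neqAle; apply/andP; split; last by lia.
  apply/eqP=> eqc; have Sa1: S a.+1 by apply: S_gap; rewrite ?eqc.
  have /in_union_cons: in_union ((c, b) :: s) (INR a.+1) by apply/s_S; rewrite leqnn.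
  case=> [[/INR_leP]|/(chain_ok_gap ok_s)]; first by lia.
  have: Rlt (INR a.+1) (INR c) by apply/INR_ltP; lia.
  by rewrite /=; lra.
exists ((a, Rplus (INR a) (Rdiv 1 2)) :: (c, b) :: s); split.
  split; first lra.
  by split=> //; move/INR_leP: lt_a2c; rewrite !S_INR /=; lra.
move=> j; rewrite in_union_cons; split.
  case=> [[/INR_leP leaj leja]|/s_S/andP[? ->]]; last by lia.
  suff ->: j = a by rewrite leqnn.
  apply/eqP; rewrite eqn_leq leaj andbT -ltnS; apply/INR_ltP; rewrite S_INR; lra.
case/andP; rewrite leq_eqVlt => /predU1P[<- _|ltaj Sj]; first by left; lra.
by right; apply/s_S; rewrite ltaj.
Qed.

(* The integers of J_k are k - 1 and k; only those in 0, ..., l - 1 matter, so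
   [CLmem l Is k j] is meant for j < l. *)
Definition CLmem (l : nat) (Is : seq (seq (nat * R))) (k j : nat) : bool :=
  if k <= l then (k == j) || (k == j.+1)
  else int_trace (nth [::] Is (k - l.+1)) j.

Lemma CLfam_CLmem l Is k j : CLmem l Is k j -> CLfam l Is k (INR j).
Proof.
rewrite /CLmem /CLfam; case: ifP => _; last by move/int_traceP.
have := pos_INR j; case: k => [|k] j_ge0; first by rewrite orbF => /eqP<-.
by case/orP=> /eqP; [move=> <-|case=> ->]; rewrite -[_ == 0]/false !S_INR; lra.
Qed.

Lemma CLmem_rshift l Is i j : CLmem l Is (l.+1 + i) j = int_trace (nth [::] Is i) j.
Proof. by rewrite /CLmem leqNgt ltnS leq_addr /= addKn. Qed.

(** * Intersections and cliques in a CL-family *)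

Section Chains.
Variables (l : nat) (Is : seq (seq (nat * R))).
Hypothesis l_gt0 : 0 < l.
Hypothesis ok_Is : forall i, i < size Is -> chain_ok l (nth [::] Is i).

Lemma CLfam_floor k x : k < l.+1 + size Is -> l < k -> CLfam l Is k x ->
  exists n, [/\ Rle (INR n) x, Rlt x (Rplus (INR n) 1), n < l & CLmem l Is k n].
Proof.
move=> lt_k ltlk; rewrite /CLfam /CLmem leqNgt ltlk /=.
by apply: int_trace_floor; apply: ok_Is; lia.
Qed.

Lemma CLfam_low k x : k <= l -> CLfam l Is k x ->
  [/\ Rle 0 x, Rle (Rminus (INR k) 1) x & Rle x (INR k)].
Proof.
rewrite /CLfam => ->; case: eqP => [-> -> | /eqP]; first by rewrite /=; split; lra.
rewrite -lt0n => k_gt0 [lekx lexk]; split=> //.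
by move/INR_leP: k_gt0; rewrite /=; lra.
Qed.

(** Take u < v. If both index path intervals, a common point forces v = u + 1, and u is a common
    integer. Otherwise v indexes some I, and the floor of a common point works: in J_u this floor is
    u - 1 or u. *)
Lemma CLfam_meet u v : u < l.+1 + size Is -> v < l.+1 + size Is -> u != v ->
  (exists x, CLfam l Is u x /\ CLfam l Is v x) <->
  (exists2 j, j < l & CLmem l Is u j && CLmem l Is v j).
Proof.
move=> lt_u lt_v neq_uv; split; last first.
  by case=> j _ /andP[uj vj]; exists (INR j); split; apply: CLfam_CLmem.
case=> x [ux vx]; wlog ltuv: u v lt_u lt_v neq_uv ux vx / u < v.
  move=> IH; have := neq_uv; rewrite neq_ltn => /orP[ltuv | ltvu].
    exact: IH ux vx ltuv.
  have [|j ltj] := IH _ _ lt_v lt_u _ vx ux ltvu; first by rewrite eq_sym.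
  by rewrite andbC; exists j.
have [levl|ltlv] := leqP v l.
  have [_ _ lexu] := CLfam_low (ltnW (leq_trans ltuv levl)) ux.
  have [_ lexv _] := CLfam_low levl vx.
  have/INR_leP: Rle (INR v) (INR u.+1) by rewrite S_INR; lra.
  move=> levu; exists u; first by lia.
  by rewrite /CLmem levl (ltnW (leq_trans ltuv levl)); lia.
have [n [lenx ltxn ltnl vn]] := CLfam_floor lt_v ltlv vx.
exists n => //; rewrite vn andbT.
have [leul|ltlu] := leqP u l.
  have [x_ge0 leux lexu] := CLfam_low leul ux; rewrite /CLmem leul.
  have/INR_leP: Rle (INR n) (INR u) by lra.
  have/INR_ltP: Rlt (INR u) (INR n.+2) by rewrite !S_INR; lra.
  by lia.
move: ux; rewrite /CLfam /CLmem leqNgt ltlu /= => ux.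
exact/int_traceP/(in_union_floor lenx ltxn).
Qed.

Hypothesis helly : forall S : {set 'I_(size Is)},
  (forall p q, p \in S -> q \in S -> p != q ->
     exists x, in_union (nth [::] Is p) x /\ in_union (nth [::] Is q) x) ->
  exists x, forall p, p \in S -> in_union (nth [::] Is p) x.
Hypothesis boundary : forall (p q : 'I_(size Is)) (j : nat),
  (exists x, in_union (nth [::] Is p) x /\ in_union (nth [::] Is q) x) ->
  int_trace (nth [::] Is p) j -> ~~ int_trace (nth [::] Is q) j ->
  ~~ int_trace (nth [::] Is p) j.+1 -> ~~ int_trace (nth [::] Is q) j.+1.

Let N := l.+1 + size Is.

Lemma CLmem_idx u : u < N -> l < u ->
  exists2 i : 'I_(size Is), u = l.+1 + i & forall j, CLmem l Is u j = int_trace (nth [::] Is i) j.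
Proof.
rewrite /N => lt_u ltlu; have lt_i: u - l.+1 < size Is by lia.
exists (Ordinal lt_i) => [|j] /=; first by lia.
by rewrite /CLmem leqNgt ltlu.
Qed.

Lemma CLmem_bridge u j : u < N -> l < u ->
  CLmem l Is u j -> CLmem l Is u j.+2 -> CLmem l Is u j.+1.
Proof.
move=> lt_u ltlu; have [i _ memE] := CLmem_idx lt_u ltlu; rewrite !memE.
move=> /int_traceP ij /int_traceP ij2.
exact/int_traceP/(in_union_bridge (ok_Is (ltn_ord i))).
Qed.

(** Split by how many of J_0, ..., J_l belong to the clique: at least two, exactly one, or none. The
    last case is the Helly condition (iii). *)
Lemma clique_common (A : {set 'I_N}) :
    (forall u v, u \in A -> v \in A -> u != v ->
       exists2 j, j < l & CLmem l Is u j && CLmem l Is v j) ->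
  exists2 j, j < l & forall u, u \in A -> CLmem l Is u j.
Proof.
move=> cliqueA.
have memJ (u : nat) j : u <= l -> CLmem l Is u j = (u == j) || (u == j.+1).
  by rewrite /CLmem => ->.
(* Two path intervals that meet are J_j and J_(j+1). Another member [w] meets them in [j1] and [j2];
   if neither is [j], they are j - 1 and j + 1, and [w] contains [j] by [CLmem_bridge]. *)
have [/existsP[u /andP[Au /existsP[v /and3P[Av levl ltuv]]]] | noJ2] :=
    boolP [exists u in A, exists v in A, (v <= l) && (u < v)].
  have leul := leq_trans (ltnW ltuv) levl.
  have nequv : u != v by apply: contraTneq ltuv => ->; rewrite ltnn.
  have [j ltjl] := cliqueA _ _ Au Av nequv.
  rewrite !memJ // => uvj; exists j => // w Aw.
  have [->|neqwu] := eqVneq w u; first by rewrite memJ //; lia.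
  have [->|neqwv] := eqVneq w v; first by rewrite memJ //; lia.
  have [j1 ltj1 /andP[wj1]] := cliqueA _ _ Aw Au neqwu; rewrite memJ // => uj1.
  have [j2 ltj2 /andP[wj2]] := cliqueA _ _ Aw Av neqwv; rewrite memJ // => vj2.
  have [lewl|ltlw] := leqP w l.
    rewrite -val_eqE /= in neqwu; rewrite -val_eqE /= in neqwv.
    by rewrite !memJ // in wj1 wj2; lia.
  have [<- //|neqj1] := eqVneq j1 j.
  have [<- //|neqj2] := eqVneq j2 j.
  have eqj1 : j = j1.+1 by lia.
  have eqj2 : j2 = j1.+2 by lia.
  by rewrite eqj1; apply: CLmem_bridge; rewrite -?eqj2.
(* With J_u as the only path interval, every other member contains u - 1 or u; the common integer is
   u if possible, and u - 1 otherwise. *)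
have [/existsP[u /andP[Au leul]] | noJ] := boolP [exists u in A, u <= l].
  have highA w : w \in A -> w != u -> l < w.
    move=> Aw neqwu; rewrite ltnNge; apply: contra noJ2 => lewl.
    rewrite -val_eqE /= in neqwu; move: neqwu; rewrite neq_ltn => /orP[ltwu | ltuw]; last first.
      by apply/existsP; exists u; rewrite Au; apply/existsP; exists w; rewrite Aw lewl.
    by apply/existsP; exists w; rewrite Aw; apply/existsP; exists u; rewrite Au leul.
  have meet_u w : w \in A -> w != u ->
      exists2 j, j < l & CLmem l Is w j /\ ((u == j :> nat) || (u == j.+1 :> nat)).
    move=> Aw /(cliqueA _ _ Aw Au)[j ltjl /andP[wj]].
    by rewrite memJ // => uj; exists j.
  have [/andP[ltul /forallP all_u] | ] :=
      boolP ((u < l) && [forall w, (w \in A) ==> CLmem l Is w u]).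
    by exists u => // w Aw; apply: implyP (all_u w) Aw.
  rewrite negb_and => not_all.
  (* The integer u fails only if u = l or some member [p] misses it. Both force u > 0, since l > 0
     and every set meeting J_0 contains 0. *)
  have [u_gt0 last_u] : 0 < u /\ (u = l :> nat \/
      exists2 p, p \in A & (p != u) && ~~ CLmem l Is p u).
    case/orP: not_all => [|]; first by split; [lia | left; lia].
    case/forallPn=> p; rewrite negb_imply => /andP[Ap p'u].
    have neqpu : p != u by apply: contraNneq p'u => ->; rewrite memJ // eqxx.
    split; last by right; exists p => //; rewrite neqpu.
    have [j _ [pj uj]] := meet_u p Ap neqpu.
    by case/orP: uj p'u => /eqP-> //; rewrite pj.
  have [k def_u] : {k | u = k.+1 :> nat} by exists u.-1; rewrite prednK.
  have ltkl : k < l by lia.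
  exists k => // w Aw.
  have [->|neqwu] := eqVneq w u; first by rewrite memJ // def_u eqxx orbT.
  have [j ltjl [wj uj]] := meet_u w Aw neqwu.
  have [<- // | neqjk] := eqVneq j k.
  have def_j : j = u by lia.
  (* Now [w] contains u, which excludes u = l. So [p] contains k but not k + 1 = u, and by (iv) a
     set [w] meeting [p] and missing k would miss u too. *)
  case: last_u => [|[p Ap /andP[neqpu p'u]]]; first by lia.
  have [j' ltj' [pj' uj']] := meet_u p Ap neqpu.
  have def_j' : j' = k.
    by apply/eqP; apply: contraNT p'u => neqj'; have <-: j' = u by lia.
  have neqwp : w != p by apply: contraNneq p'u => <-; rewrite -def_j.
  have [j3 ltj3 wpj3] := cliqueA _ _ Aw Ap neqwp.
  have [ip def_p memp] := CLmem_idx (ltn_ord p) (highA p Ap neqpu).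
  have [iw def_w memw] := CLmem_idx (ltn_ord w) (highA w Aw neqwu).
  rewrite memw; apply: contraT => w'k.
  have pk : CLmem l Is p k by rewrite -def_j'.
  rewrite memp in pk.
  have := boundary (p := ip) (q := iw) _ pk w'k.
  rewrite -def_u -memp -memw p'u -def_j wj; apply=> //.
  apply/(int_trace_meet _ (ok_Is (ltn_ord ip))).
  by exists j3 => //; rewrite -memp -memw andbC.
have highA w : w \in A -> l < w.
  by move=> Aw; rewrite ltnNge; apply: contra noJ => lewl; apply/existsP; exists w; rewrite Aw.
pose S : {set 'I_(size Is)} := [set i | rshift l.+1 i \in A].
have [|x Sx] := helly (S := S).
  move=> p q; rewrite !inE => Ap Aq neqpq; apply/(int_trace_meet _ (ok_Is (ltn_ord p))).
  have [|j ltjl] := cliqueA _ _ Ap Aq; first by rewrite (inj_eq (@rshift_inj _ _)).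
  by rewrite !CLmem_rshift => pqj; exists j.
have [A0|[u Au]] := set_0Vmem A; first by exists 0 => // w; rewrite A0 inE.
have memS w : w \in A -> exists2 i : 'I_(size Is), i \in S &
    forall j, CLmem l Is w j = int_trace (nth [::] Is i) j.
  move=> Aw; have [i def_w memE] := CLmem_idx (ltn_ord w) (highA w Aw).
  exists i => //; rewrite inE; suff <-: w = rshift l.+1 i by []; exact: val_inj.
have [i Si _] := memS u Au.
have [n [lenx ltxn ltnl _]] := int_trace_floor (ok_Is (ltn_ord i)) (Sx _ Si).
exists n => // w /memS[k Sk ->].
exact/int_traceP/(in_union_floor lenx ltxn)/Sx.
Qed.
End Chains.

(** * Components, maximal cliques and induced paths *)

Section Graph.
Variables (T : finType) (e : rel T).
Hypotheses (e_sym : symmetric e) (e_irr : irreflexive e).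

Definition max_cliques (C : {set T}) : {set {set T}} :=
  [set A | maxset (clique e) A & A \subset C].

Lemma cliqueP (A : {set T}) :
  reflect {in A &, forall x y, x != y -> e x y} (clique e A).
Proof.
apply: (iffP forall_inP) => [cA x y Ax Ay /(implyP (forall_inP (cA x Ax) y Ay)) // | cA x Ax].
by apply/forall_inP=> y Ay; apply/implyP; apply: cA.
Qed.

Lemma component_eq (C : {set T}) x : C \in components e -> x \in C ->
  C = [set y | connect e x y].
Proof.
case/imsetP=> z _ ->; rewrite inE => zx; apply/setP=> y; rewrite !inE.
exact: (same_connect (sym_connect_sym e_sym) zx).
Qed.

Lemma component_neq0 (C : {set T}) : C \in components e -> exists x, x \in C.
Proof. by case/imsetP=> x _ ->; exists x; rewrite inE connect0. Qed.

Lemma clique_sub_component (A C : {set T}) x : C \in components e ->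
  clique e A -> x \in A -> x \in C -> A \subset C.
Proof.
move=> compC /cliqueP cA Ax Cx; rewrite (component_eq compC Cx).
apply/subsetP=> y Ay; rewrite inE; have [->|neqxy] := eqVneq x y; first exact: connect0.
exact/connect1/cA.
Qed.

(** In a nonempty graph the empty clique is not maximal, being contained in a singleton. *)
Lemma max_clique_neq0 (A : {set T}) : 0 < #|T| -> maxset (clique e) A -> exists x, x \in A.
Proof.
move/card_gt0P=> [x _] /maxsetP[_ maxA]; apply/set0Pn/eqP=> A0.
have: clique e [set x] by apply/cliqueP=> y z /set1P-> /set1P->; rewrite eqxx.
by move/maxA; rewrite A0 sub0set => /(_ isT)/setP/(_ x); rewrite !inE eqxx.
Qed.

(** A maximal clique is nonempty and connected, so it lies in exactly one component, which [comp]
    returns. *)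
Lemma num_max_cliques_sum : 0 < #|T| ->
  num_max_cliques e = \sum_(C in components e) #|max_cliques C|.
Proof.
move=> T_gt0; pose comp (A : {set T}) : {set T} := [set y | [exists x in A, connect e x y]].
have compE A x : maxset (clique e) A -> x \in A -> comp A = [set y | connect e x y].
  move=> /maxsetp/cliqueP cA Ax; apply/setP=> y; rewrite !inE.
  apply/exists_inP/idP=> [[z Az zy]|]; last by exists x.
  apply: connect_trans zy; have [->|neqxz] := eqVneq x z; first exact: connect0.
  exact/connect1/cA.
rewrite /num_max_cliques -sum1_card (partition_big comp (mem (components e))) /=.
  apply: eq_bigr => C compC; rewrite -sum1_card; apply: eq_bigl => A.
  rewrite !inE; apply: andb_id2l => maxA.
  have [x Ax] := max_clique_neq0 T_gt0 maxA.
  apply/eqP/idP=> [<-|/subsetP/(_ x Ax) Cx].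
    apply/subsetP=> y Ay; rewrite inE; apply/exists_inP; exists y => //; exact: connect0.
  by rewrite (component_eq compC Cx) (compE A x maxA Ax).
move=> A; rewrite inE => maxA; have [x Ax] := max_clique_neq0 T_gt0 maxA.
by rewrite (compE A x) //; apply/imsetP; exists x.
Qed.

(** Indexing by all natural numbers avoids ordinals in index arithmetic. Only the values below [n]
    matter, and [n] counts vertices, so the length is n - 1. *)
Definition induced_path (C : {set T}) (n : nat) (v : nat -> T) : Prop :=
  [/\ forall i, i < n -> v i \in C,
      forall i j, i < n -> j < n -> v i = v j -> i = j &
      forall i j, i < n -> j < n -> e (v i) (v j) = (i.+1 == j) || (j.+1 == i)].

Lemma induced_path_tuple (C : {set T}) n x0 (t : n.-tuple T) :
  induced_path_in e C t -> induced_path C n (nth x0 t).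
Proof.
case/and3P=> uniq_t /allP tC /forallP et; split=> [i ltin|i j ltin ltjn|i j ltin ltjn].
- by apply: tC; rewrite mem_nth ?size_tuple.
- by move/eqP; rewrite nth_uniq ?size_tuple // => /eqP.
have /forallP/(_ (Ordinal ltjn))/eqP := et (Ordinal ltin).
by rewrite !(tnth_nth x0).
Qed.

Lemma leq_longest_induced_path (C : {set T}) k v :
  induced_path C k.+1 v -> k <= longest_induced_path e C.
Proof.
case=> vC inj_v ev; pose t := [tuple v i | i < k.+1].
have uniq_t : uniq t.
  by rewrite map_inj_uniq ?enum_uniq // => i j /inj_v/val_inj->.
have ltk : k < #|T|.+1.
  by have := max_card (mem t); rewrite (card_uniqP uniq_t) size_tuple; lia.
have pt : induced_path_in e C t.
  apply/and3P; split=> //; first by apply/allP=> _ /mapP[i _ ->]; apply: vC.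
  by apply/forallP=> i; apply/forallP=> j; rewrite !tnth_mktuple ev.
apply: (@leq_bigmax_cond _ _ (fun i : 'I__ => i : nat) (Ordinal ltk)).
by apply/existsP; exists t.
Qed.

(** A single vertex is an induced path, so the maximum is over a nonempty range and is attained. *)
Lemma longest_induced_path_exists (C : {set T}) : (exists x, x \in C) ->
  exists v, induced_path C (longest_induced_path e C).+1 v.
Proof.
case=> x Cx; rewrite /longest_induced_path.
pose P (k : 'I_(#|T|.+1)) := [exists t : k.+1.-tuple T, induced_path_in e C t].
have [|k /existsP[t pt] ->] := @eq_bigmax_cond _ P (fun k => k : nat).
  apply/card_gt0P; exists ord0; apply/existsP; exists [tuple x].
  rewrite /induced_path_in /= Cx; apply/forallP=> i; apply/forallP=> j.
  by rewrite (ord1 i) (ord1 j) e_irr.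
by exists (nth x t); apply: induced_path_tuple pt.
Qed.

(** For adjacent [x] and [y] the default [set0] never occurs, since every clique extends to a
    maximal one. *)
Definition edge_clique (x y : T) : {set T} :=
  odflt set0 [pick A | maxset (clique e) A && ([set x; y] \subset A)].

Lemma edge_cliqueP x y : e x y ->
  [/\ maxset (clique e) (edge_clique x y), x \in edge_clique x y & y \in edge_clique x y].
Proof.
move=> exy; rewrite /edge_clique; case: pickP => [A /andP[maxA]|no_max].
  by rewrite subUset !sub1set => /andP[Ax Ay].
have [|A maxA sA] := @maxset_exists _ (clique e) [set x; y].
  by apply/cliqueP=> z t /set2P[]-> /set2P[]->; rewrite ?eqxx // e_sym.
by have := no_max A; rewrite maxA sA.
Qed.

(** * Maximal cliques through the edges of an induced path *)

Section Path.
Variables (C : {set T}) (l : nat) (v : nat -> T).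
Hypothesis path_v : induced_path C l.+1 v.

Let K j := edge_clique (v j) (v j.+1).

Lemma path_clique j : j < l ->
  [/\ maxset (clique e) (K j), v j \in K j, v j.+1 \in K j & clique e (K j)].
Proof.
move=> ltjl; have [_ _ ev] := path_v.
have [|maxK Kj Kj1] := @edge_cliqueP (v j) (v j.+1); first by rewrite ev ?eqxx //; lia.
by split=> //; apply: maxsetp maxK.
Qed.

(** A further path vertex in [K j] would be adjacent to both [v j] and [v j.+1], which an induced
    path excludes. *)
Lemma mem_path_clique i j : i <= l -> j < l -> (v i \in K j) = (i == j) || (i == j.+1).
Proof.
move=> leil ltjl; have [_ _ ev] := path_v; have [_ Kj Kj1 /cliqueP cK] := path_clique ltjl.
apply/idP/idP=> [Ki|/orP[/eqP-> | /eqP->] //]; apply/orP.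
have [_|neqij] := eqVneq i j; first by left.
have [_|neqij1] := eqVneq i j.+1; first by right.
have := cK _ _ Ki Kj; have := cK _ _ Ki Kj1; have [_ inj_v _] := path_v.
rewrite !ev //; try lia.
have neqv: v i != v j by apply: contraNneq neqij => /inj_v->; lia.
have neqv1: v i != v j.+1 by apply: contraNneq neqij1 => /inj_v->; lia.
by move=> /(_ neqv1) h1 /(_ neqv) h2; lia.
Qed.

Lemma path_clique_inj i j : i < l -> j < l -> K i = K j -> i = j.
Proof.
move=> ltil ltjl eqK; have [_ Ki Ki1 _] := path_clique ltil.
by move: Ki Ki1; rewrite eqK !mem_path_clique //; lia.
Qed.

Lemma card_path_cliques : #|[set K i | i : 'I_l]| = l.
Proof.
rewrite card_imset ?card_ord // => i j /path_clique_inj eq_ij.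
by apply: val_inj; apply: eq_ij.
Qed.

Hypothesis compC : C \in components e.

Lemma path_cliques_sub : [set K i | i : 'I_l] \subset max_cliques C.
Proof.
apply/subsetP=> _ /imsetP[i _ ->]; have [maxK Ki _ cK] := path_clique (ltn_ord i).
rewrite inE maxK /=; apply: (clique_sub_component compC cK Ki).
by case: path_v => vC _ _; apply: vC; have := ltn_ord i; lia.
Qed.

Lemma path_leq_max_cliques : l <= #|max_cliques C|.
Proof. by rewrite -{1}card_path_cliques subset_leq_card // path_cliques_sub. Qed.

Hypothesis card_max : #|max_cliques C| = l.

(** The [l] distinct cliques [K i] exhaust the [l] maximal cliques of [C], and every clique extends
    to a maximal one. *)
Lemma path_clique_cover (A : {set T}) : clique e A -> A \subset C -> A != set0 ->
  exists2 j, j < l & A \subset K j.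
Proof.
move=> cA sAC /set0Pn[x Ax]; have [B maxB sAB] := maxset_exists cA.
have: B \in max_cliques C.
  rewrite inE maxB; have Bx := subsetP sAB x Ax.
  exact: clique_sub_component compC (maxsetp maxB) Bx (subsetP sAC x Ax).
have/eqP<-: [set K i | i : 'I_l] == max_cliques C.
  by rewrite eqEcard path_cliques_sub card_path_cliques card_max /=.
by case/imsetP=> i _ defB; exists i; rewrite -?defB.
Qed.

Lemma adj_path_clique x y : x \in C -> y \in C -> x != y ->
  e x y <-> exists2 j, j < l & (x \in K j) && (y \in K j).
Proof.
move=> Cx Cy neqxy; split=> [exy|[j ltjl /andP[Kx Ky]]]; last first.
  by have [_ _ _ /cliqueP cK] := path_clique ltjl; apply: cK.
have [|||j ltjl] := @path_clique_cover [set x; y].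
- by apply/cliqueP=> z t /set2P[]-> /set2P[]->; rewrite ?eqxx // e_sym.
- by rewrite subUset !sub1set Cx.
- by apply/set0Pn; exists x; rewrite set21.
by rewrite subUset !sub1set; exists j.
Qed.

Lemma triangle_path_clique x y z : x \in C -> y \in C -> z \in C ->
    e x y -> e y z -> e x z ->
  exists2 j, j < l & [&& x \in K j, y \in K j & z \in K j].
Proof.
move=> Cx Cy Cz exy eyz exz.
have [|||j ltjl] := @path_clique_cover [set x; y; z].
- apply/cliqueP=> s t; rewrite !inE -!orbA.
  by do 2![case/or3P=> /eqP->]; rewrite ?eqxx // e_sym.
- by rewrite !subUset !sub1set Cx Cy.
- by apply/set0Pn; exists x; rewrite !inE eqxx.
by rewrite !subUset !sub1set -andbA; exists j.
Qed.

(** A one-vertex clique lies in some [K j] with [j < l]. *)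
Lemma path_length_gt0 : 0 < l.
Proof.
have [x Cx] := component_neq0 compC.
have [||| j] := @path_clique_cover [set x]; last by lia.
- by apply/cliqueP=> y z /set1P-> /set1P->; rewrite eqxx.
- by rewrite sub1set.
by apply/set0Pn; exists x; rewrite set11.
Qed.

End Path.
End Graph.

(** * The equivalence for a single component *)

Section Component.
Variables (T : finType) (e : rel T).
Hypotheses (e_sym : symmetric e) (e_irr : irreflexive e).

Lemma longest_leq_max_cliques (C : {set T}) : C \in components e ->
  longest_induced_path e C <= #|max_cliques e C|.
Proof.
move=> compC; have [v path_v] := longest_induced_path_exists e_irr (component_neq0 compC).
exact: (path_leq_max_cliques e_sym path_v).
Qed.

Lemma CL_component (C : {set T}) : C \in components e -> iso_connected_CL e C ->
  longest_induced_path e C = #|max_cliques e C|.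
Proof.
move=> compC [l [Is [[l_gt0 [ok_Is [helly boundary]]] [f [inj_f [im_f adj_f]]]]]].
have {}ok_Is i : i < size Is -> chain_ok l (nth [::] Is i) by case/ok_Is.
have adjE (u v : 'I_(l.+1 + size Is)) : u != v -> e (f u) (f v) <->
    exists2 j, j < l & CLmem l Is u j && CLmem l Is v j.
  by move=> neq_uv; rewrite adj_f // CLfam_meet.
apply/eqP; rewrite eqn_leq longest_leq_max_cliques //=.
apply: (@leq_trans l); last first.
  pose v i := f (inord i).
  have eq_v i : i < l.+1 -> nat_of_ord (inord i : 'I_(l + size Is).+1) = i.
    by move=> lti; rewrite inordK //; lia.
  apply: (@leq_longest_induced_path _ _ _ _ v); split.
  - by move=> i _; rewrite -im_f imset_f.
  - by move=> i j lti ltj /inj_f/(congr1 val); rewrite /= !eq_v.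
  move=> i j lti ltj; have [->|neqij] := eqVneq i j; first by rewrite e_irr; lia.
  have neqv: (inord i : 'I_(l + size Is).+1) != inord j by rewrite -val_eqE /= !eq_v.
  have memE k m : k < l.+1 ->
      CLmem l Is (inord k : 'I_(l + size Is).+1) m = (k == m) || (k == m.+1).
    by move=> ltk; rewrite /CLmem eq_v // -ltnS ltk.
  apply/idP/idP=> [/(adjE _ _ neqv)[k _]|ij]; first by rewrite !memE //; lia.
  apply/(adjE _ _ neqv); case/orP: ij => /eqP ij; [exists i | exists j]; rewrite ?memE //; lia.
(* All vertices whose set contains [j] form a clique. A maximal clique has a common integer [j], so
   it is contained in [Q j] and equals it, which leaves at most [l] of them. *)
pose Q (j : 'I_l) : {set T} := f @: [set k : 'I_(l.+1 + size Is) | CLmem l Is k j].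
have cQ j : clique e (Q j).
  apply/cliqueP=> _ _ /imsetP[u uj ->] /imsetP[v vj ->]; rewrite (inj_eq inj_f).
  by rewrite !inE in uj vj; move/adjE=> adj; apply/adj; exists j; rewrite ?uj.
rewrite -[leqRHS]card_ord -cardsT; apply: leq_trans (leq_imset_card Q _).
apply/subset_leq_card/subsetP=> A; rewrite inE => /andP[/maxsetP[cA maxA] sAC].
have [||j ltjl common] := @clique_common l Is l_gt0 ok_Is helly _ (f @^-1: A).
  move=> p q j /boundary bd /int_traceP pj /int_traceP qj /int_traceP.
  rewrite S_INR => pj1; apply/int_traceP; rewrite S_INR; apply: (bd _ _ _).1 => //.
  move=> u v; rewrite !inE => Au Av neq_uv; apply/adjE => //.
  by move/cliqueP: cA; apply; rewrite ?(inj_eq inj_f).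
apply/imsetP; exists (Ordinal ltjl); rewrite ?inE //.
apply/esym/maxA; first exact: cQ.
apply/subsetP=> x Ax; have: x \in f @: setT by rewrite im_f (subsetP sAC).
by case/imsetP=> u _ def_x; rewrite def_x imset_f // inE common // inE -def_x.
Qed.

Lemma component_CL (C : {set T}) : C \in components e ->
  longest_induced_path e C = #|max_cliques e C| -> iso_connected_CL e C.
Proof.
move=> compC; have [v] := longest_induced_path_exists e_irr (component_neq0 compC).
set l := longest_induced_path e C => path_v /esym card_max.
have l_gt0 : 0 < l := path_length_gt0 e_sym path_v compC card_max.
have [vC inj_v ev] := path_v.
pose K j := edge_clique e (v j) (v j.+1).
have mem_vK i j : i <= l -> j < l -> (v i \in K j) = (i == j) || (i == j.+1).
  exact: (mem_path_clique e_sym path_v).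
have triangle x y z : x \in C -> y \in C -> z \in C -> e x y -> e y z -> e x z ->
    exists2 j, j < l & [&& x \in K j, y \in K j & z \in K j].
  exact: (triangle_path_clique e_sym path_v compC card_max).
have adjK x y : x \in C -> y \in C -> x != y ->
    e x y <-> exists2 j, j < l & (x \in K j) && (y \in K j).
  exact: (adj_path_clique e_sym path_v compC card_max).
have adj_v x i j : x \in C -> i <= l -> x != v i -> j < l -> (i == j) || (i == j.+1) ->
    x \in K j -> e x (v i).
  move=> Cx leil neqx ltjl ij Kx; apply/adjK; rewrite ?vC //.
  by exists j => //; rewrite Kx mem_vK.
have cover A : clique e A -> A \subset C -> A != set0 -> exists2 j, j < l & A \subset K j.
  exact: (path_clique_cover e_sym path_v compC card_max).
pose others := [seq x <- enum C | x \notin [seq v i | i <- iota 0 l.+1]].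
have uniq_others : uniq others by apply: filter_uniq; apply: enum_uniq.
have othersP x : x \in others -> x \in C /\ forall i, i <= l -> x != v i.
  rewrite mem_filter mem_enum => /andP[notv Cx]; split=> // i leil.
  by apply: contraNneq notv => ->; rewrite map_f // mem_iota.
pose S x j := (j < l) && (x \in K j).
(* A vertex [x] of K_j and K_(j+2) forms a triangle with v_(j+1) and v_(j+2). Among the K_i only
   K_(j+1) contains both of these, so [x] lies in it: this is the gap hypothesis of [runs_of]. The
   empty list is a dummy outside [others]. *)
have runs x : {s | x \in others -> chain_ok l s /\ forall j, int_trace s j = S x j}.
  have [/othersP[Cx notv]|_] := boolP (x \in others); last by exists [::].
  have [|j /andP[ltjl Kj] /andP[ltj2l Kj2]|s ok_s] := @runs_of l (S x); last by exists s.
    by move=> j /andP[].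
  have [||||||i ltil] := triangle x (v j.+1) (v j.+2); rewrite ?vC //; try lia.
  - by apply: (adj_v _ _ j) => //; [apply: notv; lia | rewrite eqxx orbT].
  - by rewrite ev ?eqxx //; lia.
  - by apply: (adj_v _ _ j.+2) => //; [lia | apply: notv; lia | rewrite eqxx].
  rewrite /S !mem_vK //; try lia.
  by case/and3P=> Ki ij1 ij2; have <-: i = j.+1 by [lia]; apply/andP.
pose Is := [seq sval (runs x) | x <- others].
have size_Is : size Is = size others by rewrite size_map.
(* Numbering as in [CLfam]: path vertices first, the others from [l.+1] on. The default [v 0] is not
   reached for indices in range. *)
pose g k := if k <= l then v k else nth (v 0) others (k - l.+1).
have others_nth i : i < size Is -> nth (v 0) others i \in others.
  by rewrite size_Is; apply: mem_nth.
have nth_Is i : i < size Is ->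
    chain_ok l (nth [::] Is i) /\ forall j, int_trace (nth [::] Is i) j = S (g (l.+1 + i)) j.
  move=> lti; rewrite /g leqNgt ltnS leq_addr /= addKn.
  rewrite (nth_map (v 0)) -?size_Is //.
  by apply: (svalP (runs _)); apply: others_nth.
have g_mem k j : k < l.+1 + size Is -> j < l -> CLmem l Is k j = (g k \in K j).
  move=> ltk ltjl; have [lekl|ltlk] := leqP k l.
    by rewrite /CLmem /g lekl mem_vK.
  have def_k : k = l.+1 + (k - l.+1) by rewrite subnKC.
  rewrite def_k CLmem_rshift; have [|_ ->] := nth_Is (k - l.+1); first by lia.
  by rewrite /S ltjl.
have gC k : k < l.+1 + size Is -> g k \in C.
  move=> ltk; rewrite /g; case: leqP => [lekl|ltlk]; first exact: vC.
  by have [|//] := othersP (nth (v 0) others (k - l.+1)); apply: others_nth; lia.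
have inj_g k1 k2 : k1 < l.+1 + size Is -> k2 < l.+1 + size Is -> g k1 = g k2 -> k1 = k2.
  move=> ltk1 ltk2; rewrite /g.
  have notv k m : k < l.+1 + size Is -> l < k -> m <= l -> nth (v 0) others (k - l.+1) <> v m.
    move=> ltk ltlk leml; have [|_ notv] := othersP (nth (v 0) others (k - l.+1)).
      by apply: others_nth; lia.
    exact/eqP/notv.
  case: leqP => [le1|lt1]; case: leqP => [le2|lt2].
  - exact: inj_v.
  - by move/esym/notv; case.
  - by move/notv; case.
  have lt_others k : k < l.+1 + size Is -> l < k -> k - l.+1 < size others by lia.
  by move/eqP; rewrite nth_uniq ?lt_others // => /eqP; lia.
have ok_Is i : i < size Is -> chain_ok l (nth [::] Is i) by case/nth_Is.
have adj_g k1 k2 : k1 < l.+1 + size Is -> k2 < l.+1 + size Is -> k1 != k2 ->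
    e (g k1) (g k2) <-> exists x, CLfam l Is k1 x /\ CLfam l Is k2 x.
  move=> ltk1 ltk2 neqk; rewrite CLfam_meet // adjK ?gC //; last first.
    by apply: contra_neq neqk; apply: inj_g.
  by split=> -[j ltjl mem12]; exists j; rewrite ?g_mem // in mem12 *.
exists l, Is; split; last first.
  exists g; split; first by move=> k1 k2 /inj_g eqk; apply/val_inj/eqk.
  split; last by move=> k1 k2 neqk; apply: adj_g.
  apply/setP=> x; apply/imsetP/idP=> [[k _ ->]|Cx]; first exact: gC.
  have [/mapP[i] |x'v] := boolP (x \in [seq v i | i <- iota 0 l.+1]).
    rewrite mem_iota => /andP[_ lti] ->.
    have ltiN : i < l.+1 + size Is by lia.
    by exists (Ordinal ltiN); rewrite // /g /= -ltnS lti.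
  have x_others : x \in others by rewrite mem_filter x'v mem_enum.
  have ltx : l.+1 + index x others < l.+1 + size Is by rewrite ltn_add2l size_Is index_mem.
  exists (Ordinal ltx); rewrite // /g /= leqNgt ltnS leq_addr /= addKn.
  by rewrite nth_index.
have othersI i : i < size Is -> g (l.+1 + i) \in others.
  by move=> lti; rewrite /g leqNgt ltnS leq_addr /= addKn; apply: others_nth.
have gI_C i : i < size Is -> g (l.+1 + i) \in C by case/othersI/othersP.
have traceE i j : i < size Is -> int_trace (nth [::] Is i) j = (j < l) && (g (l.+1 + i) \in K j).
  by case/nth_Is.
have meetE p q : p < size Is -> q < size Is -> p != q ->
    (exists x, in_union (nth [::] Is p) x /\ in_union (nth [::] Is q) x) ->
    e (g (l.+1 + p)) (g (l.+1 + q)).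
  move=> ltp ltq neqpq /(int_trace_meet _ (ok_Is p ltp))[j ltjl].
  rewrite !traceE // ltjl => pq; apply/adjK; rewrite ?gI_C //; last by exists j.
  by apply: contra_neq neqpq => /inj_g/eqP; rewrite eqn_add2l !ltn_add2l => /(_ ltp ltq)/eqP.
split=> //; split; last split.
(* Every vertex of [C] lies in some [K j], so its list of intervals has an integer in its union and
   is nonempty. *)
- move=> i lti; split; last exact: ok_Is.
  have [|||j ltjl] := cover [set g (l.+1 + i)].
  + by apply/cliqueP=> y z /set1P-> /set1P->; rewrite eqxx.
  + by rewrite sub1set gI_C.
  + by apply/set0Pn; exists (g (l.+1 + i)); rewrite set11.
  rewrite sub1set => Kj; have: int_trace (nth [::] Is i) j by rewrite traceE // ltjl.
  by case: (nth _ _ _).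
(* Sets meeting pairwise come from a clique, and a [K j] containing it gives the common integer.
   [cover] asks for a nonempty clique, so the empty family is treated apart. *)
- move=> P meetP; have [->|/set0Pn[p0 Pp0]] := eqVneq P set0.
    by exists R0 => p; rewrite inE.
  have [|||j ltjl subK] := cover [set g (l.+1 + i) | i : 'I_(size Is) in P].
  + apply/cliqueP=> _ _ /imsetP[p Pp ->] /imsetP[q Pq ->] neq_pq.
    have neqpq : p != q by apply: contraNneq neq_pq => ->.
    by apply: meetE => //; apply: meetP.
  + by apply/subsetP=> _ /imsetP[p _ ->]; apply: gI_C.
  + by apply/set0Pn; exists (g (l.+1 + p0)); apply: imset_f.
  exists (INR j) => p Pp; apply/int_traceP; rewrite traceE // ltjl.
  by apply: (subsetP subK); apply: imset_f.
move=> p q j meet_pq /int_traceP pj /int_traceP q'j.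
have neqpq : p != q by apply: contraNneq q'j => <-.
have epq := meetE p q (ltn_ord p) (ltn_ord q) neqpq meet_pq.
(* This serves both halves of (iv): j and k are consecutive, and v_m is the common vertex of their
   edges. If [q] contained k, the triangle on [p], [q] and v_m would lie in K_j or K_k; as [q] is
   not in K_j, it would lie in K_k, so [p] would contain k. *)
have step k m : k < l -> m <= l -> k != j -> (m == j) || (m == j.+1) -> (m == k) || (m == k.+1) ->
    ~~ int_trace (nth [::] Is p) k -> ~~ int_trace (nth [::] Is q) k.
  move=> ltkl leml neqkj mj mk; apply: contra => qk.
  move: pj q'j qk; rewrite !traceE // => /andP[ltjl pj]; rewrite ltjl ltkl /= => q'j qk.
  have [_ pv] := othersP _ (othersI p (ltn_ord p)).
  have [_ qv] := othersP _ (othersI q (ltn_ord q)).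
  have [||||||i ltil /and3P[Kp Kq]] := triangle (g (l.+1 + p)) (g (l.+1 + q)) (v m);
    rewrite ?gI_C ?vC //.
  - by apply: (adj_v _ _ k) => //; [apply: gI_C | apply: qv].
  - by apply: (adj_v _ _ j) => //; [apply: gI_C | apply: pv].
  rewrite mem_vK // => mi; have [<- //|neqik] := eqVneq i k.
  by have eqij : i = j by [lia]; rewrite -eqij Kq in q'j.
have ltjl := int_trace_lt (ok_Is p (ltn_ord p)) pj.
split.
  rewrite -S_INR => /int_traceP p'j1; apply/int_traceP.
  have [ltj1l|lelj1] := ltnP j.+1 l.
    by apply: (step _ j.+1) => //; rewrite ?eqxx ?orbT //; lia.
  by rewrite traceE // ltnNge lelj1.
(* For j = 0 the point j - 1 is negative, outside every set. *)
case: j => [|j] in pj q'j ltjl step *.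
  by move=> _ /(chain_ok_bounds (ok_Is q (ltn_ord q)))[]; rewrite /=; lra.
have ->: Rminus (INR j.+1) R1 = INR j by rewrite S_INR; lra.
move=> /int_traceP p'j; apply/int_traceP.
by apply: (step _ j.+1) => //; rewrite ?eqxx ?orbT //; lia.
Qed.
End Component.

Theorem theorem2p3 (T : finType) (e : rel T)
  (e_sym : symmetric e) (e_irr : irreflexive e) (T_nonempty : (0 < #|T|)%N) :
  ell e = num_max_cliques e <-> is_CL_graph e.
Proof.
rewrite (num_max_cliques_sum e_sym) // /ell; split=> [/eqP eq_sum C compC | CL].
  have leif C' : C' \in components e -> longest_induced_path e C' <= #|max_cliques e C'|
      ?= iff (longest_induced_path e C' == #|max_cliques e C'|).
    by move=> compC'; split=> //; apply: longest_leq_max_cliques.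
  (* Termwise inequalities whose sums agree are equalities. *)
  have [_] := leqif_sum leif; rewrite eq_sum => /esym/forall_inP/(_ C compC)/eqP.
  exact: component_CL.
by apply: eq_bigr => C compC; apply: CL_component => //; apply: CL.
Qed.
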